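(* Let $\triangle ABC$ be an equilateral triangle and let $\gamma$ be the Fagnano orbit on it. If $\alpha$ is a periodic orbit on $\triangle ABC$ with odd period, then $\alpha=\gamma^{2k-1}$ for some integer $k\ge 1$, in which case the period of $\alpha$ is $6k-3$.
   Context: Let $R$ be the closed plane region bounded by $\triangle ABC$. A nonsingular trajectory is a piecewise linear constant (nonzero) speed curve $\alpha:\mathbb{R}\to R$, moving in straight lines between successive strikes on the sides, reflecting at each strike so that the angle of incidence equals the angle of reflection, and never reaching a vertex. It is periodic if $\alpha(a+t)=\alpha(b+t)$ for some $a<b$ and all $t\in\mathbb{R}$; its restriction to $[a,b]$ is then a periodic orbit. A periodic orbit retraces the same path exactly $n\ge1$ times (i.e. $b-a$ is $n$ times the least positive period of the trajectory as a function of time); if $n=1$ it is primitive, otherwise it is an $n$-fold iterate. If $\alpha$ is primitive, $\alpha^n$ denotes its $n$-fold iterate. The period of a periodic orbit is the number of times the ball strikes a side during the orbit (the coinciding initial and final positions being counted once); if $\alpha$ is primitive of period $k$, $\alpha^n$ has period $kn$. The Fagnano orbit $\gamma$ is the primitive orbit of period 3 that traverses the orthic triangle of $\triangle ABC$ (here the triangle whose vertices are the midpoints of the sides). Periodic orbits are regarded as the same if they differ only by speed, choice of initial point, reversal of the direction of travel, or a relabelling of the vertices (symmetry) of $\triangle ABC$. *)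

(* Defs.v *)
(* MathComp-Analysis, over an arbitrary R : realType *)
From HB Require Import structures.
From mathcomp Require Import all_boot all_order all_algebra all_fingroup.
From mathcomp Require Import finmap all_classical all_reals all_analysis.

Set Implicit Arguments.
Unset Strict Implicit.
Unset Printing Implicit Defensive.

Import Order.TTheory GRing.Theory Num.Theory.

Local Open Scope classical_set_scope.
Local Open Scope ring_scope.

Section Plane.
Variable R : realType.

Definition plane := 'rV[R]_2.

Definition dot (u v : plane) : R := (u *m v^T) 0 0.

(* The library norm on row vectors is the sup norm, hence a separate
   Euclidean norm. *)
Definition enorm (u : plane) : R := Num.sqrt (dot u u).

Definition dist (p q : plane) : R := enorm (p - q).

(* Orthogonal projection of the vector u on the line spanned by e. *)
Definition proj (e u : plane) : plane := (dot u e / dot e e) *: e.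

(* Linear reflection across the line spanned by e: the component along e is
   kept and the orthogonal component changes sign. *)
Definition reflect_along (e u : plane) : plane := proj e u *+ 2 - u.

End Plane.

Section Triangle.
Variable R : realType.

(* The three vertices; indices are read modulo 3. *)
Definition triangle := 'I_3 -> plane R.

Implicit Type T : triangle.

Definition equilateral T : Prop :=
  exists2 l : R, 0 < l & forall i j : 'I_3, i != j -> dist (T i) (T j) = l.

Definition region T : set (plane R) :=
  [set p | exists w : 'I_3 -> R,
     [/\ forall i, 0 <= w i, \sum_i w i = 1 & p = \sum_i w i *: T i]].

(* The closed side opposite to the vertex T i. *)
Definition side T (i : 'I_3) : set (plane R) :=
  [set p | exists2 s : R, 0 <= s <= 1 &
     p = (1 - s) *: T (i + 1) + s *: T (i - 1)].

Definition sides T : set (plane R) := \bigcup_(i in [set: 'I_3]) side T i.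

Definition edge T (i : 'I_3) : plane R := T (i + 1) - T (i - 1).

(* Foot of the altitude from the vertex T i. *)
Definition altitude_foot T (i : 'I_3) : plane R :=
  T (i + 1) + proj (edge T i) (T i - T (i + 1)).

Definition orthic T : triangle := altitude_foot T.

Definition symmetry T (f : plane R -> plane R) : Prop :=
  (forall p q, dist (f p) (f q) = dist p q) /\
  exists s : 'S_3, forall i, f (T i) = T (s i).

End Triangle.

Section Billiards.
Variable R : realType.
Implicit Types (T : triangle R) (f : R -> plane R).

(* Nonsingular trajectory.  The strike times are listed in increasing order as
   t_i (i : int), the pieces [t_i, t_{i+1}] cover the whole time axis, and v_i
   is the velocity on [t_i, t_{i+1}]. *)
Definition trajectory T f : Prop :=
  (forall x, region T (f x)) /\
  (forall x (i : 'I_3), f x <> T i) /\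
  exists (t : int -> R) (v : int -> plane R),
    [/\ (forall i, t i < t (i + 1)) /\ (forall x, exists i, t i <= x < t (i + 1)),
        forall x, sides T (f x) <-> exists i, x = t i,
        forall i x, t i <= x <= t (i + 1) -> f x = f (t i) + (x - t i) *: v i,
        exists2 c : R, 0 < c & forall i, enorm (v i) = c
      & forall (i : int) (j : 'I_3), side T j (f (t i)) ->
          v i = reflect_along (edge T j) (v (i - 1))].

(* An orbit is the restriction of [curve] to [start, stop]; keeping the whole
   motion loses nothing, since it is determined by one period. *)
Record billiard_orbit :=
  BilliardOrbit { curve : R -> plane R; start : R; stop : R }.

Implicit Types o : billiard_orbit.

Definition periodic_orbit T o : Prop :=
  [/\ trajectory T (curve o), start o < stop o
    & forall x, curve o (start o + x) = curve o (stop o + x)].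

Definition least_period f (p : R) : Prop :=
  [/\ 0 < p, periodic f p & forall q, 0 < q -> periodic f q -> p <= q].

Definition primitive o : Prop := least_period (curve o) (stop o - start o).

Definition iterate o (n : nat) : billiard_orbit :=
  BilliardOrbit (curve o) (start o) (start o + (stop o - start o) *+ n).

(* Number of strikes.  The interval is half-open so that the coinciding initial
   and final positions count once.  The set is finite for a periodic orbit. *)
Definition period T o : nat :=
  #|` fset_set [set x | start o <= x < stop o /\ sides T (curve o x)]|%fset.

Definition fagnano T o : Prop :=
  [/\ periodic_orbit T o, primitive o, period T o = 3%N
    & curve o @` [set x | start o <= x <= stop o] = sides (orthic T)].

(* Identification of orbits up to speed, initial point, direction (the sign
   of c) and symmetry of the triangle.  The initial points need not
   correspond; the lengths of the time intervals must. *)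
Definition same_orbit T o1 o2 : Prop :=
  exists (g : plane R -> plane R) (c d : R),
    [/\ symmetry T g, c != 0,
        forall x, curve o1 x = g (curve o2 (c * x + d))
      & stop o2 - start o2 = `|c| * (stop o1 - start o1)].

End Billiards.

(* Main.v *)
Require Import Defs.
From mathcomp Require Import all_boot all_order all_algebra all_reals.
From mathcomp Require Import ring lra zify.
From mathcomp Require Import all_fingroup finmap all_classical all_analysis.

(** Why an odd orbit is an iterate of the Fagnano orbit.

    In barycentric coordinates (w_0, w_1, w_2) of an equilateral triangle, a
    velocity becomes a triple om of derivatives with sum zero, and reflection
    in the side j becomes om_i |-> - om_{-i-j}, with indices modulo 3
    ([bvel_reflect]).  An odd number n of reflections therefore has the form
    om_i |-> - om_{-i-s}.  Along a periodic orbit with n strikes every velocity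
    is fixed by such a map, which at i = s gives om_s = 0: the ball always
    moves parallel to a side ([om_axis], [om_next]).

    A ball leaving the side j parallel to a side must be moving parallel to
    neither j nor the side it will hit, so the reflection law forces the sides
    to be struck in cyclic order ([sides_step], [sides_cycle]).  Closing up
    after n strikes makes n a multiple of 3 ([three_dvd]).  Along a flight
    between the sides j and j' the third coordinate is constant and the other
    two trade places; hence the distance of the strike point from the middle of
    its side changes sign at each strike when measured along the cyclic
    order.  As n is odd and the orbit closes up, this distance is zero: all
    strikes are at midpoints ([hit_midpoint]), and all flights last equally
    long ([flight_time_const]).

    The whole motion is thus an affine change of time of one fixed curve, the
    one running through the midpoints ([odd_orbit_normal_form]).  The Fagnano
    orbit has period 3, which is odd, so it has the same normal form, and the
    two time changes compose to the required identification. *)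

Set Implicit Arguments.
Unset Strict Implicit.
Unset Printing Implicit Defensive.

Import Order.TTheory GRing.Theory Num.Theory.
Local Open Scope classical_set_scope.
Local Open Scope ring_scope.

(** * Indices modulo 3 *)

Lemma ord3_cases (j i : 'I_3) : [\/ i = j, i = j + 1 | i = j - 1].
Proof.
by move: i j; do 2!case=> [[|[|[|//]]] ?];
  try (by apply: Or31; apply/val_inj); try (by apply: Or32; apply/val_inj);
  apply: Or33; apply/val_inj.
Qed.

Lemma ord3_addd (j : 'I_3) : j + 1 + 1 = j - 1.
Proof. by case: j => [[|[|[|//]]] ?]; apply/val_inj. Qed.

Lemma ord3_subb (j : 'I_3) : j - 1 - 1 = j + 1.
Proof. by case: j => [[|[|[|//]]] ?]; apply/val_inj. Qed.

Lemma ord3_oppD (j : 'I_3) : - j - j = j.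
Proof. by case: j => [[|[|[|//]]] ?]; apply/val_inj. Qed.

Lemma ord3_neq (j : 'I_3) : (j + 1 == j = false) * (j - 1 == j = false) *
  (j == j + 1 = false) * (j == j - 1 = false) *
  (j + 1 == j - 1 = false) * (j - 1 == j + 1 = false).
Proof. by case: j => [[|[|[|//]]] ?]. Qed.

Lemma ord3_sum (V : nmodType) (F : 'I_3 -> V) (j : 'I_3) :
  \sum_i F i = F j + F (j + 1) + F (j - 1).
Proof.
rewrite (bigD1 j) //= (bigD1 (j + 1)) ?ord3_neq //=.
rewrite (big_pred1 (j - 1)) ?addrA //.
by move=> i /=; case: (ord3_cases j i) => ->; rewrite ?eqxx ?ord3_neq ?eqxx.
Qed.

(** * The Euclidean inner product *)

Section Dot.
Variable R : realType.
Implicit Types u v w : plane R.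

Lemma dotE u v : dot u v = u 0 0 * v 0 0 + u 0 1 * v 0 1.
Proof.
rewrite /dot mxE big_ord_recl big_ord1 !mxE.
by congr (_ * _ + u _ _ * v _ _); apply/val_inj.
Qed.
Lemma dotC u v : dot u v = dot v u.
Proof. by rewrite !dotE ![u _ _ * _]mulrC. Qed.
Lemma dotDl u v w : dot (u + v) w = dot u w + dot v w.
Proof. rewrite !dotE !mxE; ring. Qed.
Lemma dotZl (a : R) u w : dot (a *: u) w = a * dot u w.
Proof. rewrite !dotE !mxE; ring. Qed.
Lemma dotNl u w : dot (- u) w = - dot u w.
Proof. by rewrite -scaleN1r dotZl mulN1r. Qed.
Lemma dotDr u v w : dot u (v + w) = dot u v + dot u w.
Proof. by rewrite dotC dotDl !(dotC u). Qed.
Lemma dotNr u w : dot u (- w) = - dot u w.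
Proof. by rewrite dotC dotNl dotC. Qed.
Lemma dot_ge0 u : 0 <= dot u u.
Proof. by rewrite dotE addr_ge0 // -expr2 sqr_ge0. Qed.
Lemma sqr_enorm u : dot u u = enorm u ^+ 2.
Proof. by rewrite /enorm sqr_sqrtr ?dot_ge0. Qed.
End Dot.

(** * Barycentric coordinates of points and velocities *)

Section Bary.
Variables (R : realType) (T : triangle R).
Hypothesis eqT : equilateral T.
Implicit Types (p u v : plane R) (i j : 'I_3).

(** The derivative of the i-th barycentric coordinate in the direction v.  For
    an equilateral triangle, edge (i - 1) - edge (i + 1) =
    2 T_i - T_{i+1} - T_{i-1} is twice the altitude from T_i and has squared
    length 3 times that of a side, whence the constant 2 / 3. *)
Definition bvel i v : R :=
  2 / 3 * (dot v (edge T (i - 1) - edge T (i + 1)) / dot (edge T i) (edge T i)).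

(** Vanishing on the side i is expressed by taking the vertex T_{i+1} of that
    side as base point. *)
Definition bary i p : R := bvel i (p - T (i + 1)).

Lemma edge_sum i : edge T i + edge T (i + 1) + edge T (i - 1) = 0.
Proof.
by rewrite /edge ord3_addd ord3_subb addrK subrK !addrA !subrK subrr.
Qed.

(** The edges have equal length and sum to zero, so that any two of them make
    an angle of 120 degrees. *)
Lemma edge_dot : exists2 L : R, 0 < L &
  [/\ forall i, dot (edge T i) (edge T i) = L,
      forall i, dot (edge T i) (edge T (i + 1)) = - (L / 2)
    & forall i, dot (edge T i) (edge T (i - 1)) = - (L / 2)].
Proof.
case: eqT => l l0 hl.
have hL i : dot (edge T i) (edge T i) = l ^+ 2.
  by rewrite sqr_enorm /edge -(hl (i + 1) (i - 1)) ?ord3_neq.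
have h1 i : dot (edge T i) (edge T (i + 1)) = - (l ^+ 2 / 2).
  have e2 : edge T (i - 1) = - (edge T i + edge T (i + 1)).
    by apply/eqP; rewrite -addr_eq0 addrC edge_sum.
  have := hL (i - 1); rewrite e2; move: (hL i) (hL (i + 1)).
  move: (edge T i) (edge T (i + 1)) => a b; rewrite !dotE !mxE => *; lra.
exists (l ^+ 2); first exact: exprn_gt0.
split=> // i.
by rewrite dotC -[in edge T i](subrK 1 i) h1.
Qed.

Lemma bvelD i u v : bvel i (u + v) = bvel i u + bvel i v.
Proof. by rewrite /bvel dotDl; ring. Qed.
Lemma bvelZ i (a : R) v : bvel i (a *: v) = a * bvel i v.
Proof. by rewrite /bvel dotZl; ring. Qed.
Lemma bvelN i v : bvel i (- v) = - bvel i v.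
Proof. by rewrite -scaleN1r bvelZ mulN1r. Qed.

Lemma bvel_edge i j : bvel i (edge T j) = (i == j + 1)%:R - (i == j - 1)%:R.
Proof.
have [L L0 [h0 h1 h2]] := edge_dot.
rewrite /bvel (dotDr (edge T j) (edge T _)) (dotNr (edge T j) (edge T _)) h0.
case: (ord3_cases j i) => ->; rewrite ?ord3_neq ?eqxx ?addrK ?subrK ?ord3_addd
  ?ord3_subb ?h0 ?h1 ?h2 /=; field; rewrite gt_eqF //.
Qed.

(** Reflection along edge j fixes that edge and sends edge (j + 1) to
    edge (j - 1): up to a sign, it permutes the coordinates.  The formula
    i |-> - i - j modulo 3 for the transposition fixing j makes compositions of
    reflections computable without cases. *)
Lemma bvel_reflect i j v :
  bvel i (reflect_along (edge T j) v) = - bvel (- i - j) v.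
Proof.
have [L L0 [h0 h1 h2]] := edge_dot.
rewrite /reflect_along bvelD bvelN mulr2n bvelD /proj bvelZ bvel_edge h0.
have e2 : edge T (j - 1) = - (edge T j + edge T (j + 1)).
  by apply/eqP; rewrite -addr_eq0 addrC edge_sum.
have E : [/\ - j - j = j, - (j + 1) - j = j - 1 & - (j - 1) - j = j + 1].
  by case: j {e2} => [[|[|[|//]]] ?]; split; apply/val_inj.
case: E => E1 E2 E3.
case: (ord3_cases j i) => ->; rewrite ?E1 ?E2 ?E3 ?ord3_neq ?eqxx /bvel
  ?h0 ?addrK ?subrK ?ord3_addd ?ord3_subb ?e2 !(dotDr, dotNr) /=;
  field; rewrite gt_eqF //.
Qed.

Lemma bary_vertex i j : bary i (T j) = (i == j)%:R.
Proof.
rewrite /bary; case: (ord3_cases i j) => ->; rewrite ?ord3_neq ?eqxx.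
- by have := bvel_edge i (i - 1);
    rewrite /edge subrK ord3_subb => ->; rewrite eqxx ord3_neq subr0.
- by rewrite subrr -(scale0r 0) bvelZ mul0r.
- by rewrite -opprB bvelN -/(edge T i) bvel_edge !ord3_neq subrr oppr0.
Qed.

(** Hence the weights in the definition of the region are unique and are
    affine functions of the point. *)
Lemma bary_sum (w : 'I_3 -> R) i :
  \sum_k w k = 1 -> bary i (\sum_k w k *: T k) = w i.
Proof.
move=> w1; rewrite /bary -[T (i + 1)]scale1r -w1 scaler_suml -sumrB.
rewrite (ord3_sum _ i) -!scalerBr !bvelD !bvelZ -!/(bary i _).
rewrite !bary_vertex eqxx !ord3_neq /= !mulr0 mulr1 !addr0 //.
Qed.

Lemma baryD i p v : bary i (p + v) = bary i p + bvel i v.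
Proof. rewrite /bary -bvelD; congr bvel; exact: addrAC. Qed.

Lemma region_bary p : region T p ->
  [/\ forall i, 0 <= bary i p, \sum_i bary i p = 1
    & p = \sum_i bary i p *: T i].
Proof.
case=> w [w0 w1 ->]; split=> [i||]; first by rewrite bary_sum.
  by rewrite -[RHS]w1; apply: eq_bigr => i _; rewrite bary_sum.
by apply: eq_bigr => i _; rewrite bary_sum.
Qed.

Lemma side_bary p j : region T p -> side T j p <-> bary j p = 0.
Proof.
move=> /region_bary [p0 p1 pE]; split=> [[s s01 ->]|pj].
  have -> : (1 - s) *: T (j + 1) + s *: T (j - 1) =
     \sum_i (if i == j then 0 else if i == j + 1 then 1 - s else s) *: T i.
    by rewrite (ord3_sum _ j) !eqxx !ord3_neq scale0r add0r.
  by rewrite bary_sum ?eqxx // (ord3_sum _ j) !eqxx !ord3_neq add0r subrK.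
move: p1 pE; rewrite !(ord3_sum _ j) pj scale0r !add0r => p1 pE.
exists (bary (j - 1) p); first by rewrite p0 -p1 lerDr p0.
by rewrite {1}pE -p1 addrK.
Qed.

(** If two coordinates vanished, the point would be the third vertex. *)
Lemma side_bary_gt0 p j i : region T p -> (forall k, p <> T k) ->
  side T j p -> i != j -> 0 < bary i p.
Proof.
move=> Rp pV /(side_bary j Rp) pj ij.
case: (region_bary Rp) => p0 p1 pE.
rewrite lt_def p0 andbT; apply/eqP => pi.
have [k [ki kj]] : exists k, \sum_l bary l p = bary k p /\
  \sum_l bary l p *: T l = bary k p *: T k.
  move: ij pi; case: (ord3_cases j i) => ->; rewrite ?eqxx ?ord3_neq // => _ pi.
    by exists (j - 1); rewrite !(ord3_sum _ j) pj pi !scale0r !add0r.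
  by exists (j + 1); rewrite !(ord3_sum _ j) pj pi !scale0r !add0r !addr0.
by apply: (pV k); rewrite pE kj -ki p1 scale1r.
Qed.

End Bary.

(** * The combinatorics of an odd periodic sequence of strikes *)

Lemma int_const (X : Type) (g : int -> X) :
  (forall k, g (k + 1) = g k) -> forall k, g k = g 0.
Proof.
move=> h; elim/int_ind => // n ih; first by rewrite -ih intS addrC h.
by rewrite -ih -[LHS]h -addn1 PoszD opprD subrK.
Qed.

(** What remains of the motion in coordinates: [w k] is the k-th strike point,
    [om k] the velocity after it, [D k] the duration of the flight that follows
    and [j k] the side struck.  The hypothesis [om_side] says that the ball
    leaves the side that it strikes. *)
Section BouncingCoordinates.
Variables (R : realType) (w om : int -> 'I_3 -> R) (D : int -> R).
Variables (j : int -> 'I_3) (n : nat).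
Hypothesis w_side : forall k, w k (j k) = 0.
Hypothesis w_gt0 : forall k i, i != j k -> 0 < w k i.
Hypothesis w_sum : forall k, \sum_i w k i = 1.
Hypothesis D_gt0 : forall k, 0 < D k.
Hypothesis w_step : forall k i, w (k + 1) i = w k i + D k * om k i.
Hypothesis om_reflect : forall k i, om (k + 1) i = - om k (- i - j (k + 1)).
Hypothesis om_side : forall k, om k (j k) != 0.
Hypothesis om_period : forall k i, om (k + n%:Z) i = om k i.
Hypothesis w_period : forall k i, w (k + n%:Z) i = w k i.
Hypothesis n_odd : odd n.

(** An even number of reflections rotates the three coordinates; an odd number
    reverses their order and changes their sign. *)
Lemma om_compose k m : exists s, forall i,
  om (k + m%:Z) i = if odd m then - om k (- i - s) else om k (i - s).
Proof.
elim: m => [|m [s ih]].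
  by exists 0 => i; rewrite /= (subr0 i) (addr0 k).
exists (if odd m then s - j (k + m%:Z + 1) else s + j (k + m%:Z + 1)) => i.
rewrite (_ : k + m.+1%:Z = k + m%:Z + 1) ?om_reflect; last lia.
rewrite ih /=; case: (odd m) => /=; first by rewrite opprK; congr om; ring.
by congr (- om k _); ring.
Qed.

Lemma om_axis k : exists s, forall i, om k i = - om k (- i - s).
Proof.
have [s hs] := om_compose k n; exists s => i.
by rewrite -{1}om_period hs n_odd.
Qed.

(** The axis index s of [om_axis] is the third side: on the struck sides
    j k and j (k + 1) the coordinate om is not zero, since the ball leaves the
    first and reaches the second. *)
Lemma om_next k : [/\ j (k + 1) != j k, om k (j (k + 1)) = - om k (j k)
  & om k (- j k - j (k + 1)) = 0].
Proof.
have [s hs] := om_axis k.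
have om_s : om k s = 0.
  by have := hs s; rewrite ord3_oppD => h; lra.
have om_pm : om k (s + 1) = - om k (s - 1).
  by rewrite hs; congr (- om k _); case: (s) => [[|[|[|//]]] ?]; apply/val_inj.
have js : s != j k by apply: contra (om_side k) => /eqP <-; rewrite om_s.
have js' : s != j (k + 1).
  apply/eqP => e; have := w_step k s; rewrite om_s mulr0 addr0 e w_side -e => h.
  by have := w_gt0 js; rewrite -h ltxx.
have jj : j (k + 1) != j k.
  apply: contra (om_side k) => /eqP e; have := w_step k (j k).
  by rewrite -{1}e !w_side add0r => /esym/eqP; rewrite mulf_eq0 gt_eqF.
(* the three sides s, j k and j (k + 1) are distinct, so they sum to 0 *)
have e3 : - j k - j (k + 1) = s.
  move: js js' jj; move: s (j k) (j (k + 1)) {hs om_s om_pm}.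
  by (do 3!case=> [[|[|[|//]]] ?]) => //= *; apply/val_inj.
rewrite e3; split=> //; move: js js' jj.
case: (ord3_cases s (j k)) => ->; case: (ord3_cases s (j (k + 1))) => ->;
  by rewrite ?eqxx ?ord3_neq // om_pm ?opprK.
Qed.

(** After the strike k + 1 the coordinate om vanishes at j k, so the ball cannot
    go back to that side and must hit the third one. *)
Lemma sides_step k : j (k + 1 + 1) - j (k + 1) = j (k + 1) - j k.
Proof.
have [jj _ e] := om_next k; have [jj' e' _] := om_next (k + 1).
have : j (k + 1 + 1) != j k.
  apply: contra (om_side (k + 1)) => /eqP ek.
  by rewrite -oppr_eq0 -e' ek om_reflect e oppr0.
move: jj jj'; move: (j (k + 1 + 1)) (j (k + 1)) (j k).
by (do 3!case=> [[|[|[|//]]] ?]) => //= *; apply/val_inj.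
Qed.

Lemma sides_cycle : exists2 e : int, e = 1 \/ e = -1 &
  forall k, j k = j 0 + (e * k)%:~R.
Proof.
have hd := int_const sides_step.
have [jj _ _] := om_next 0.
have [e he ej] : exists2 e : int, e = 1 \/ e = -1 & j (0 + 1) - j 0 = e%:~R.
  move: jj; case: (ord3_cases (j 0) (j (0 + 1))) => ->; rewrite ?eqxx // => _.
    by exists 1; [left | rewrite addrC addKr].
  by exists (-1); [right | rewrite addrC addKr].
exists e => // k.
have h : forall k, j (k + 1) - (e * (k + 1))%:~R = j k - (e * k)%:~R.
  move=> i; rewrite mulrDr mulr1 intrD -ej -(hd i); ring.
by apply/eqP; rewrite -subr_eq (int_const h) mulr0 subr0.
Qed.

Lemma sides_period k : j (k + n%:Z) = j k.
Proof.
apply/eqP/negP => /negP ne.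
by have := w_gt0 ne; rewrite -w_period w_side ltxx.
Qed.

Lemma three_dvd : (3 %| n)%N.
Proof.
have [e he h] := sides_cycle.
have := sides_period 0; rewrite add0r h => /eqP.
rewrite -subr_eq0 addrAC subrr add0r intrM => /eqP en.
have : (n%:R : 'I_3) = 0.
  case: he en => ->; rewrite ?mul1r // mulN1r => /eqP.
  by rewrite oppr_eq0 => /eqP.
by rewrite Zp_nat => /(congr1 val) /= /eqP.
Qed.

(** Let a be the coordinate of a strike point belonging to the side that will
    be struck two strikes later (or was struck one strike before).  Each flight
    replaces a by 1 - a, and n flights restore it; since n is odd, a = 1 - a. *)
Lemma hit_midpoint k i : i != j k -> w k i = 1 / 2.
Proof.
have [jk _ _] := om_next 0.
pose d := j (0 + 1) - j 0.
have jS l : j (l + 1) = j l + d.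
  by rewrite /d -(int_const sides_step l); ring.
have d0 : d != 0 by rewrite subr_eq0.
have jw l : w l (j l - d) + w l (j l + d) = 1.
  rewrite -[RHS](w_sum l) (ord3_sum _ (j l)) w_side add0r.
  move: d0; case: (ord3_cases 0 d) => ->; rewrite ?eqxx // => _;
  by rewrite add0r ?opprK addrC.
have aS l : w (l + 1) (j (l + 1) - d) = 1 - w l (j l - d).
  have := w_step l (j l + d); rewrite -jS w_side.
  have := w_step l (j l); rewrite w_side.
  have [_ -> _] := om_next l.
  by have := jw l; rewrite jS addrK => h1 h2 h3; lra.
have am l m : w (l + m%:Z) (j (l + m%:Z) - d) =
    if odd m then 1 - w l (j l - d) else w l (j l - d).
  elim: m => [|m ih]; first by rewrite (addr0 l).
  rewrite (_ : l + m.+1%:Z = l + m%:Z + 1) ?aS ?ih /=; last lia.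
  by case: (odd m) => //=; lra.
have a2 : w k (j k - d) = 1 / 2.
  by have := am k n; rewrite n_odd sides_period w_period => h; lra.
have b2 : w k (j k + d) = 1 / 2 by have := jw k; lra.
move=> ij.
have [->|->] // : i = j k - d \/ i = j k + d.
move: d0; case: (ord3_cases 0 d) => ->; rewrite ?eqxx // !add0r => _;
  move: ij; case: (ord3_cases (j k) i) => ->; rewrite ?eqxx ?opprK;
  by [|left|right].
Qed.

Lemma speed_const k : om k (j k) = om 0 (j 0).
Proof.
apply: (int_const (g := fun k => om k (j k))) => {}k.
by rewrite om_reflect ord3_oppD; have [_ -> _] := om_next k; rewrite opprK.
Qed.

(** Every flight takes the coordinate at j k from 0 to 1 / 2, and does so at the
    same rate by [speed_const]. *)
Lemma flight_time_const k : D k = D 0.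
Proof.
have h l : D l * om l (j l) = 1 / 2.
  have [jj _ _] := om_next l.
  have := w_step l (j l); rewrite w_side add0r hit_midpoint // eq_sym //.
apply: (mulIf (om_side 0)); rewrite h -{1}(speed_const k) h //.
Qed.

End BouncingCoordinates.

(** * Strike times *)

Section Strikes.
Variables (R : realType) (t : int -> R).
Hypothesis t_lt : forall i, t i < t (i + 1).

Lemma strike_homo : {homo t : i j / i < j}.
Proof.
move=> i j ij; have [m ->] : exists m : nat, j = i + m%:Z + 1.
  by exists (absz (j - i - 1)%R); lia.
elim: m => [|m ih]; first by rewrite (addr0 i).
by apply: lt_trans ih _; rewrite (_ : i + m.+1%:Z = i + m%:Z + 1) //; lia.
Qed.

Lemma strike_lt i k : (t i < t k) = (i < k).
Proof. exact: (leW_mono (le_mono strike_homo)). Qed.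

Lemma strike_inj : injective t.
Proof. exact: (inc_inj (le_mono strike_homo)). Qed.

(** A translation preserving the set of strike times is an increasing bijection
    of that set, hence a shift of the indices: it maps consecutive strikes to
    consecutive strikes. *)
Lemma strike_shift (P : R) :
  (forall x, (exists i, x = t i) <-> (exists i, x + P = t i)) ->
  exists m : int, forall i, t (i + m) = t i + P.
Proof.
move=> tP.
have /choice [phi hphi] : forall i, exists k, t i + P = t k.
  by move=> i; apply: (tP (t i)).1; exists i.
have phiS i : phi (i + 1) = phi i + 1.
  have [l hl] : exists l, t (phi i + 1) - P = t l.
    by apply: (tP _).2; exists (phi i + 1); rewrite subrK.
  have le1 : i + 1 <= l.
    by rewrite lezD1 -strike_lt -hl ltrBrDr hphi.
  have lt1 : phi i < phi (i + 1) by rewrite -strike_lt -!hphi ltrD2r.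
  have le2 : phi (i + 1) <= phi i + 1.
    rewrite -(le_mono strike_homo) -hphi -(subrK P (t (phi i + 1))) hl lerD2r.
    by rewrite (le_mono strike_homo).
  by apply/eqP; rewrite eq_le le2 lezD1.
exists (phi 0) => i; rewrite hphi; congr t.
suff : phi i - i = phi 0 - 0 by lia.
by apply: (int_const (g := fun i => phi i - i)) => k; rewrite phiS; ring.
Qed.

(** The strikes in [a, b[ are n consecutive ones, starting with the first one
    that is not before a. *)
Lemma strike_count (a b : R) (n : nat) :
  (forall x, exists i, t i <= x < t (i + 1)) ->
  (forall i, t (i + n%:Z) = t i + (b - a)) ->
  #|` fset_set [set x | a <= x < b /\ exists i, x = t i]|%fset = n.
Proof.
move=> cov sh.
have [i0 lo hi] : exists2 i0, t (i0 - 1) < a & a <= t i0.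
  have [i /andP[ti ti1]] := cov a.
  move: ti; rewrite le_eqVlt => /orP[/eqP <-|ti].
    by exists i => //; rewrite strike_lt; lia.
  by exists (i + 1); [rewrite addrK | exact: ltW].
apply: card_fset_set.
rewrite (_ : [set x | _] = (fun r : nat => t (i0 + r%:Z)) @` `I_n); last first.
  apply/seteqP; split=> x /=.
    case=> /andP[ax xb] [i xi]; move: ax xb; rewrite xi => ax xb.
    have h1 : i0 - 1 < i by rewrite -strike_lt; exact: lt_le_trans ax.
    have h2 : i < i0 + n%:Z.
      rewrite -strike_lt sh; apply: lt_le_trans xb _; lra.
    by exists (absz (i - i0)%R); [lia | congr t; lia].
  case=> r rn <-; split; last by exists (i0 + r%:Z).
  apply/andP; split.
    by apply: le_trans hi _; rewrite (le_mono strike_homo); lia.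
  have : t (i0 + r%:Z) <= t (i0 - 1 + n%:Z).
    by rewrite (le_mono strike_homo); lia.
  move/le_lt_trans; apply; rewrite sh; lra.
apply: inj_card_eq => r s _ _ /strike_inj; lia.
Qed.

End Strikes.

(** * The curve through the midpoints of the sides *)

Section Medial.
Variables (R : realType) (T : triangle R).

(** Indexing the midpoints by all integers lets one formula describe the curve
    at all times and in both directions. *)
Definition medial_vertex (k : int) : plane R :=
  1 / 2 *: T (k%:~R + 1) + 1 / 2 *: T (k%:~R - 1).

Definition medial_curve (y : R) : plane R :=
  let k := Num.floor y in
  ((k + 1)%:~R - y) *: medial_vertex k + (y - k%:~R) *: medial_vertex (k + 1).

(** Both end points of the unit interval are allowed here, which the floor in
    the definition does not give at the right end; reversing the time exchanges
    the two ends. *)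
Lemma medial_curveE (k : int) (y : R) : k%:~R <= y <= (k + 1)%:~R ->
  medial_curve y =
  ((k + 1)%:~R - y) *: medial_vertex k + (y - k%:~R) *: medial_vertex (k + 1).
Proof.
move=> /andP[ky]; rewrite le_eqVlt => /orP[/eqP ->|yk].
  rewrite /medial_curve intrKfloor subrr !scale0r addr0 add0r.
  by congr (_ *: _); rewrite !intrD; ring.
by rewrite /medial_curve (@floor_def _ _ k) // ky.
Qed.

End Medial.

(** * Normal form of odd orbits *)

(** The barycentric coordinates of an odd orbit satisfy the hypotheses of the
    combinatorial part, and its conclusions determine the motion up to the
    starting point, the speed and the direction. *)
Lemma odd_orbit_normal_form (R : realType) (T : triangle R)
    (o : billiard_orbit R) :
  equilateral T -> periodic_orbit T o -> odd (period T o) ->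
  (3 %| period T o)%N /\ exists a b : R,
    [/\ a != 0, (stop o - start o) * `|a| = (period T o)%:R
      & forall x, curve o x = medial_curve T (a * x + b)].
Proof.
move=> eqT [[Rf [Vf [t [v [[t_lt t_cov] St Pf _ Vr]]]]] so per].
set f := curve o in Rf Vf St Pf per *; set P := stop o - start o.
have P0 : 0 < P by rewrite subr_gt0.
have fP x : f (x + P) = f x.
  have := per (x - start o); rewrite (addrC _ (x - _)) subrK => ->.
  by congr f; rewrite /P; ring.
have [m hm] : exists m : int, forall i, t (i + m) = t i + P.
  apply: (strike_shift t_lt) => x.
  by split=> /St h; apply/St; move: h; rewrite fP.
have m0 : 0 < m.
  by rewrite -(strike_lt t_lt) -[in ltRHS](add0r m) hm ltrDl.
have [n mE] : exists n : nat, m = n%:Z by exists (absz m); lia.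
subst m.
have perE : period T o = n.
  rewrite /period -(@strike_count _ _ t_lt (start o) (stop o) n t_cov hm).
  congr (#|` fset_set _|%fset); apply/seteqP; split=> x /= [h /St]; by split.
rewrite perE => n_odd.
have /choice [j hj] : forall k, exists j, side T j (f (t k)).
  move=> k; have /St : exists i, t k = t i by exists k.
  by case=> j _; exists j.
pose w k i := bary T i (f (t k)); pose om k i := bvel T i (v k).
pose D k := t (k + 1) - t k.
have D0 k : 0 < D k by rewrite subr_gt0.
have fS k : f (t (k + 1)) = f (t k) + D k *: v k.
  by rewrite -Pf // lexx ltW.
have wS k i : w (k + 1) i = w k i + D k * om k i.
  by rewrite /w fS baryD bvelZ.
have w_side k : w k (j k) = 0 by apply/(side_bary eqT).
have w_gt0 k i : i != j k -> 0 < w k i.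
  exact: side_bary_gt0.
have w_sum k : \sum_i w k i = 1 by have [] := region_bary eqT (Rf (t k)).
have om_refl k i : om (k + 1) i = - om k (- i - j (k + 1)).
  by rewrite /om (Vr (k + 1) (j (k + 1))) // addrK bvel_reflect.
have om_side k : om k (j k) != 0.
  (* otherwise the ball would slide along the side between two strikes *)
  apply/eqP => om0; pose x := t k + D k / 2.
  have tx : t k < x < t (k + 1).
    by rewrite /x; have := D0 k; rewrite /D => ?; lra.
  have [i xi] : exists i, x = t i.
    apply/St; exists (j k) => //; apply/(side_bary eqT); first exact: Rf.
    case/andP: tx => ? ?; rewrite (Pf k) ?ltW //.
    by rewrite baryD bvelZ -/(om k (j k)) om0 mulr0 addr0 -/(w k (j k)).
  by move: tx; rewrite xi !(strike_lt t_lt) ltzD1 leNgt => /andP[->].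
have w_per k i : w (k + n%:Z) i = w k i by rewrite /w hm fP.
have D_per k : D (k + n%:Z) = D k.
  by rewrite /D addrAC !hm; ring.
have om_per k i : om (k + n%:Z) i = om k i.
  have := wS (k + n%:Z) i; rewrite addrAC !w_per wS D_per => /addrI.
  by move/(mulfI (lt0r_neq0 (D0 k))).
have Dc := flight_time_const w_side w_gt0 w_sum D0 wS om_refl om_side om_per
  w_per n_odd.
have mid := hit_midpoint w_side w_gt0 w_sum D0 wS om_refl om_side om_per
  w_per n_odd.
have [e he je] := sides_cycle w_side w_gt0 D0 wS om_refl om_side om_per n_odd.
split.
  exact: (three_dvd w_side w_gt0 D0 wS om_refl om_side om_per w_per n_odd).
pose tau := D 0.
have tau0 : 0 < tau := D0 0.
have tE k : t k = t 0 + tau * k%:~R.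
  have h : t k - tau * k%:~R = t 0 - tau * 0%:~R.
    apply: (int_const (g := fun k => t k - tau * k%:~R)) => i.
    by rewrite intrD -[tau](Dc i) /D; ring.
  by rewrite -[LHS](subrK (tau * k%:~R)) h mulr0 subr0.
pose J : int := Posz (j 0).
have JE : J%:~R = j 0 :> 'I_3 by rewrite -pmulrn natr_Zp.
have fM k : f (t k) = medial_vertex T (J + e * k).
  have [_ _ ->] := region_bary eqT (Rf (t k)).
  rewrite (ord3_sum _ (j k)) -!/(w k _) w_side !mid ?ord3_neq // scale0r add0r.
  by rewrite /medial_vertex intrD JE je.
(* one unit of the parameter per flight; strike 0 is at the index J *)
exists (e%:~R / tau), (J%:~R - e%:~R * t 0 / tau).
have e1 : `|e%:~R| = 1 :> R by case: he => ->; rewrite ?normrN normr1.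
split.
- by rewrite mulf_eq0 invr_eq0 (gt_eqF tau0) orbF -normr_gt0 e1.
- rewrite normrM e1 mul1r normfV (gtr0_norm tau0).
  have := hm 0; rewrite add0r tE => /addrI <-.
  by rewrite mulrAC divff ?gt_eqF // mul1r.
move=> x; have [k /andP[tk tk1]] := t_cov x.
rewrite (Pf k); last by rewrite tk ltW.
pose u := (x - t k) / tau.
have uE : x - t k = u * D k by rewrite Dc -/tau divfK // gt_eqF.
have u01 : 0 <= u <= 1.
  rewrite ler_pdivlMr // ler_pdivrMr // mul0r mul1r subr_ge0 tk.
  by rewrite -[tau](Dc k) lerD2r ltW.
have -> : f (t k) + (x - t k) *: v k = (1 - u) *: f (t k) + u *: f (t (k + 1)).
  by rewrite fS uE scalerDr scalerA addrA -scalerDl subrK scale1r.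
have xE : x / tau = t 0 / tau + k%:~R + u.
  by rewrite /u (tE k); field; rewrite gt_eqF.
have -> : e%:~R / tau * x + (J%:~R - e%:~R * t 0 / tau) =
   J%:~R + e%:~R * (k%:~R + u).
  rewrite mulrAC -mulrA xE; ring.
rewrite !fM; case: he => ->.
  rewrite (@medial_curveE _ _ (J + k)); last by rewrite !intrD; lra.
  by congr (_ *: medial_vertex T _ + _ *: medial_vertex T _);
    rewrite ?intrD; ring.
(* backwards, the flight k runs from index J - k to J - (k + 1) *)
rewrite (@medial_curveE _ _ (J - (k + 1))); last by rewrite !(intrD,intrN); lra.
rewrite addrC.
by congr (_ *: medial_vertex T _ + _ *: medial_vertex T _);
  rewrite ?(intrD,intrN); ring.
Qed.

Theorem corollary2 (R : realType) (T : triangle R) (gamma alpha : billiard_orbit R) :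
  equilateral T -> fagnano T gamma ->
  periodic_orbit T alpha -> odd (period T alpha) ->
  exists k : nat,
    [/\ (1 <= k)%N,
        same_orbit T alpha (iterate gamma (2 * k - 1))
      & period T alpha = (6 * k - 3)%N].
Proof.
move=> eqT [gper _ g3 _] aper aodd.
have godd : odd (period T gamma) by rewrite g3.
have [_ [a' [b' [a'0 Pa' fa']]]] := odd_orbit_normal_form eqT gper godd.
have [/dvdnP[q qE] [a [b [a0 Pa fa]]]] := odd_orbit_normal_form eqT aper aodd.
have q_odd : odd q by move: aodd; rewrite qE oddM andbT.
(* the orbit makes q = 2 k - 1 turns of three strikes *)
pose k := q./2.+1.
have kE : (2 * k - 1 = q)%N.
  by rewrite /k -[in RHS](odd_double_half q) q_odd; lia.
exists k; split=> //; last by rewrite qE -kE; lia.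
(* both orbits run through the same curve, so the time change suffices *)
exists id, (a / a'), ((b - b') / a'); split.
- split=> //; exists 1%g => i; by rewrite perm1.
- by rewrite mulf_neq0 ?invr_eq0.
- move=> x /=; rewrite fa fa'; congr medial_curve; field.
  exact: a'0.
rewrite /= addrAC subrr add0r kE normrM normfV.
have a'n : `|a'| != 0 by rewrite normr_eq0.
apply: (mulIf a'n); rewrite -mulr_natr mulrAC Pa' g3.
rewrite (mulrAC `|a|) -!mulrA mulVf // mulr1 mulrC [RHS]mulrC Pa qE natrM //.
Qed.
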